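(* Let $Z=z_1e_1+z_2e_2$ and $\mathcal V=\nu_1e_1+\nu_2e_2$ be elements of $\mathbb{BC}$ with $Z\notin\mathcal O_2$. Then the bicomplex Bessel function $V=\mathcal J_{\mathcal V}(Z)$ satisfies the differential equation $$Z^2\frac{d^2V}{dZ^2}+Z\frac{dV}{dZ}+(Z^2-\mathcal V^2)V=0.$$
   Context: Bicomplex numbers: $\mathbb{BC}=\{\lambda_1+j\lambda_2:\lambda_1,\lambda_2\in\mathbb C(i)\}$ with commuting units $i,j$, $i^2=j^2=-1$, $k=ij$, $k^2=1$. Put $e_1=\frac{1+k}{2}$, $e_2=\frac{1-k}{2}$; then $e_1+e_2=1$, $e_l^2=e_l$, $e_1e_2=0$. Every $Z=\lambda_1+j\lambda_2$ has the unique idempotent representation $Z=z_1e_1+z_2e_2$ with $z_1=\lambda_1-i\lambda_2$, $z_2=\lambda_1+i\lambda_2\in\mathbb C(i)$. The set of zero divisors is $\mathcal O_2=\{\lambda_1+j\lambda_2:\lambda_1^2+\lambda_2^2=0\}=\{Z: z_1z_2=0\}$. Derivative: $g'(Z_0)=\lim_{Z\to Z_0,\ Z-Z_0\notin\mathcal O_2}\frac{g(Z)-g(Z_0)}{Z-Z_0}$; for $g(Z)=g_1(z_1)e_1+g_2(z_2)e_2$ this is $g_1'(z_1)e_1+g_2'(z_2)e_2$. Powers and Gamma: $Z^{\mathcal V}=z_1^{\nu_1}e_1+z_2^{\nu_2}e_2$, with complex powers $z^\nu=\exp(\nu\log z)$ for a fixed branch of $\log$ holomorphic near the point considered and used consistently.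 $\Gamma_b(Z)=\Gamma(z_1)e_1+\Gamma(z_2)e_2$; reciprocals $1/\Gamma$ are read as the entire function $1/\Gamma$, and a term whose coefficient is zero is zero. Bicomplex Bessel function: for $\mathcal V,Z\in\mathbb{BC}$, $$\mathcal J_{\mathcal V}(Z)=\sum_{s=0}^\infty\frac{(-1)^s}{\Gamma_b(\mathcal V+s+1)s!}\left(\frac Z2\right)^{\mathcal V+2s},$$ equivalently $\mathcal J_{\mathcal V}(Z)=J_{\nu_1}(z_1)e_1+J_{\nu_2}(z_2)e_2$ with $J_\nu$ the classical Bessel function of the first kind. *)

(* Defs.v *)
From Stdlib Require Import Reals Factorial Lra ClassicalEpsilon.
From Coquelicot Require Import Coquelicot.

Declare Scope BC_scope.
Delimit Scope BC_scope with BC.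

(** ** Bicomplex numbers *)

(* The pair (l1, l2) stands for l1 + j l2. *)
Definition BC : Type := (C * C)%type.
Bind Scope BC_scope with BC.

Definition CtoBC (a : C) : BC := (a, RtoC 0).
Definition BCplus (Z W : BC) : BC := (fst Z + fst W, snd Z + snd W)%C.
Definition BCopp (Z : BC) : BC := (- fst Z, - snd Z)%C.
Definition BCminus (Z W : BC) : BC := BCplus Z (BCopp W).
Definition BCmult (Z W : BC) : BC :=
  (fst Z * fst W - snd Z * snd W, fst Z * snd W + snd Z * fst W)%C.

(* (l1 - j l2) / (l1^2 + l2^2): the inverse of Z when Z is not in O2. *)
Definition BCinv (Z : BC) : BC :=
  let n := (fst Z * fst Z + snd Z * snd Z)%C in (fst Z / n, - snd Z / n)%C.
Definition BCdiv (Z W : BC) : BC := BCmult Z (BCinv W).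

Infix "+" := BCplus : BC_scope.
Infix "-" := BCminus : BC_scope.
Notation "- Z" := (BCopp Z) : BC_scope.
Infix "*" := BCmult : BC_scope.
Infix "/" := BCdiv : BC_scope.

Definition BCi : BC := CtoBC Ci.
Definition BCj : BC := (RtoC 0, RtoC 1).
Definition BCk : BC := (BCi * BCj)%BC.
Definition e1 : BC := ((CtoBC 1 + BCk) / CtoBC 2)%BC.
Definition e2 : BC := ((CtoBC 1 - BCk) / CtoBC 2)%BC.

(** [O2 Z]: the element [Z] belongs to the set of zero divisors (0 included). *)
Definition O2 (Z : BC) : Prop := (fst Z * fst Z + snd Z * snd Z)%C = RtoC 0.

(** Idempotent components and the element with given components. *)
Definition idem1 (Z : BC) : C := (fst Z - Ci * snd Z)%C.
Definition idem2 (Z : BC) : C := (fst Z + Ci * snd Z)%C.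
Definition of_idem (z1 z2 : C) : BC := (CtoBC z1 * e1 + CtoBC z2 * e2)%BC.

Lemma Ci_sqr : (Ci * Ci = - RtoC 1)%C.
Proof. unfold Ci, Cmult, Copp, RtoC; simpl; f_equal; ring. Qed.

Lemma C2_neq0 : RtoC 2 <> RtoC 0.
Proof. intros H; apply RtoC_inj in H; lra. Qed.

Lemma C4_neq0 : (RtoC 2 * RtoC 2 + RtoC 0 * RtoC 0)%C <> RtoC 0.
Proof.
  replace (RtoC 2 * RtoC 2 + RtoC 0 * RtoC 0)%C with (RtoC 2 * RtoC 2)%C by ring.
  apply Cmult_neq_0; exact C2_neq0.
Qed.

Lemma e1_pair : e1 = (/ 2, Ci / 2)%C.
Proof.
  unfold e1, BCdiv, BCinv, BCk, BCi, BCj, CtoBC, BCplus, BCmult; simpl.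
  f_equal; field; auto using C2_neq0, C4_neq0.
Qed.

Lemma e2_pair : e2 = (/ 2, - (Ci / 2))%C.
Proof.
  unfold e2, BCdiv, BCinv, BCk, BCi, BCj, CtoBC, BCminus, BCopp, BCplus, BCmult;
    simpl.
  f_equal; field; auto using C2_neq0, C4_neq0.
Qed.

Lemma of_idemE (z1 z2 : C) :
  of_idem z1 z2 = ((z1 + z2) / 2, Ci * (z1 - z2) / 2)%C.
Proof.
  unfold of_idem; rewrite e1_pair, e2_pair.
  unfold CtoBC, BCplus, BCmult; simpl; f_equal; field; exact C2_neq0.
Qed.

Lemma of_idemK (Z : BC) : of_idem (idem1 Z) (idem2 Z) = Z.
Proof.
  destruct Z as [a b]; rewrite of_idemE; unfold idem1, idem2; simpl.
  f_equal; [field; exact C2_neq0|].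
  transitivity (- (Ci * Ci) * b)%C; [field; exact C2_neq0|].
  rewrite Ci_sqr; ring.
Qed.

Lemma idem1K (z1 z2 : C) : idem1 (of_idem z1 z2) = z1.
Proof.
  rewrite of_idemE; unfold idem1; simpl.
  transitivity ((z1 + z2) / 2 - (Ci * Ci) * (z1 - z2) / 2)%C.
  - field; exact C2_neq0.
  - rewrite Ci_sqr; field; exact C2_neq0.
Qed.

Lemma idem2K (z1 z2 : C) : idem2 (of_idem z1 z2) = z2.
Proof.
  rewrite of_idemE; unfold idem2; simpl.
  transitivity ((z1 + z2) / 2 + (Ci * Ci) * (z1 - z2) / 2)%C.
  - field; exact C2_neq0.
  - rewrite Ci_sqr; field; exact C2_neq0.
Qed.

Lemma O2_idem (Z : BC) : O2 Z <-> (idem1 Z * idem2 Z)%C = RtoC 0.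
Proof.
  replace (idem1 Z * idem2 Z)%C with (fst Z * fst Z - (Ci * Ci) * (snd Z * snd Z))%C
    by (unfold idem1, idem2; ring).
  rewrite Ci_sqr; unfold O2.
  replace (fst Z * fst Z - - RtoC 1 * (snd Z * snd Z))%C
    with (fst Z * fst Z + snd Z * snd Z)%C by ring.
  tauto.
Qed.

Lemma BCmult_inv (Z : BC) : ~ O2 Z -> (Z * BCinv Z)%BC = CtoBC 1.
Proof.
  unfold O2; intros H; unfold BCmult, BCinv, CtoBC; simpl.
  f_equal; field; exact H.
Qed.

(** ** Bicomplex limits, derivatives and series *)

Definition BC_NormedModule : NormedModule C_AbsRing :=
  prod_NormedModule C_AbsRing C_NormedModule C_NormedModule.

Definition is_BC_derive (g : BC -> BC) (Z0 l : BC) : Prop :=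
  filterlim (fun Z => (g Z - g Z0) / (Z - Z0))%BC
    (within (fun Z => ~ O2 (Z - Z0)%BC) (locally (T := BC_NormedModule) Z0))
    (locally (T := BC_NormedModule) l).

Definition is_BC_derive2 (g : BC -> BC) (Z0 l : BC) : Prop :=
  exists g' : BC -> BC,
    locally (T := BC_NormedModule) Z0 (fun Z => is_BC_derive g Z (g' Z)) /\
    is_BC_derive g' Z0 l.

(* Unspecified when the series diverges. *)
Definition BC_Series (a : nat -> BC) : BC :=
  epsilon (inhabits (CtoBC 0)) (is_series (V := BC_NormedModule) a).

(** ** Complex exponential, branches of the logarithm, powers *)

Definition Cexp (z : C) : C := (exp (fst z) * cos (snd z), exp (fst z) * sin (snd z))%R.

(** [L] is, near [w], a holomorphic branch of the complex logarithm. *)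
Definition log_branch_near (L : C -> C) (w : C) : Prop :=
  locally (T := C_UniformSpace) w (fun x =>
    Cexp (L x) = x /\ ex_derive (K := C_AbsRing) (V := C_NormedModule) L x).

Definition cpow (L : C -> C) (z nu : C) : C := Cexp (nu * L z)%C.

Definition BCpow (L : C -> C) (Z N : BC) : BC :=
  of_idem (cpow L (idem1 Z) (idem1 N)) (cpow L (idem2 Z) (idem2 N)).

(** ** The reciprocal of the Gamma function *)

(* z (z + 1) ... (z + n - 1) *)
Fixpoint Crising (z : C) (n : nat) : C :=
  match n with
  | O => RtoC 1
  | S m => (Crising z m * (z + RtoC (INR m)))%C
  end.

(* Gauss' formula 1/Gamma(z) = lim z (z + 1) ... (z + n) / (n! n^z), which defines
   the entire function 1/Gamma at every z, the poles of Gamma included.  The value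
   of the sequence at n = 0 is irrelevant. *)
Definition rGamma (z : C) : C :=
  iota (T := C_CompleteNormedModule) (fun l =>
    filterlim
      (fun n : nat =>
        (Crising z (S n) / (RtoC (INR (fact n)) * Cexp (z * RtoC (ln (INR n)))))%C)
      eventually (locally (T := C_CompleteNormedModule) l)).

Definition rGamma_b (Z : BC) : BC := of_idem (rGamma (idem1 Z)) (rGamma (idem2 Z)).

(** ** The bicomplex Bessel function of order [N] *)

(* Powers are taken with the branch [L], used at the idempotent components of Z / 2. *)
Definition bessel_term (L : C -> C) (N Z : BC) (s : nat) : BC :=
  (CtoBC (RtoC ((-1) ^ s / INR (fact s)))
   * rGamma_b (N + CtoBC (RtoC (INR s)) + CtoBC 1)
   * BCpow L (Z / CtoBC 2) (N + CtoBC (RtoC (INR (2 * s)))))%BC.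

Definition bessel (L : C -> C) (N Z : BC) : BC := BC_Series (bessel_term L N Z).

(* Main.v *)
Require Import Defs.
From Stdlib Require Import Reals Factorial Lra Lia ClassicalEpsilon.
From Coquelicot Require Import Coquelicot.

(* In idempotent coordinates the Bessel function, its derivatives and the equation
   split into two copies of the classical complex statement.  On C, write x = z / 2;
   since exp (L x) = x, the Bessel series is exp (nu L(x)) F(x^2) with F entire with
   coefficients c_s = (-1)^s / (s! Gamma(nu + s + 1)).  The equation 1/Gamma(a) =
   a (1/Gamma(a + 1)), read off Gauss' limit (whose convergence comes from consecutive
   terms having ratio 1 + O(1/n^2)), gives (s + 1) (nu + s + 1) c_(s+1) = - c_s, that
   is w F'' + (nu + 1) F' + F = 0; substituting w = x^2 and multiplying by the power
   gives the Bessel equation.  The same functional equation bounds 1/Gamma(nu + s + 1)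
   in s, whence F is entire. *)

(** * The complex exponential *)

Lemma Cexp_plus (a b : C) : Cexp (a + b)%C = (Cexp a * Cexp b)%C.
Proof.
  destruct a as [a a'], b as [b b']; unfold Cexp, Cplus, Cmult; simpl.
  rewrite exp_plus, cos_plus, sin_plus; f_equal; ring.
Qed.

Lemma Cexp_0 : Cexp (RtoC 0) = RtoC 1.
Proof. unfold Cexp, RtoC; simpl; rewrite exp_0, cos_0, sin_0; f_equal; ring. Qed.

Lemma Cexp_neq0 (a : C) : Cexp a <> RtoC 0.
Proof.
  intros H; apply R1_neq_R0, RtoC_inj.
  rewrite <- Cexp_0 at 1.
  replace (RtoC 0) with (a + - a)%C by ring.
  rewrite Cexp_plus, H; ring.
Qed.

Lemma Cexp_RtoC (x : R) : Cexp (RtoC x) = RtoC (exp x).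
Proof. unfold Cexp, RtoC; simpl; rewrite cos_0, sin_0; f_equal; ring. Qed.

(** Both bounds come from 1 + x <= exp x. Used at -x it gives exp x (1 - x) <= 1, while (1 + x + 2
    x^2)(1 - x) = 1 + x^2 (1 - 2 x) >= 1. *)
Lemma Rabs_exp_taylor (x : R) : Rabs x <= / 2 -> Rabs (exp x - 1 - x) <= 2 * x ^ 2.
Proof.
  intros H; apply Rabs_le_between in H.
  pose proof (exp_ineq1_le x) as H1; pose proof (exp_ineq1_le (- x)) as H2.
  rewrite exp_Ropp in H2.
  rewrite Rabs_pos_eq by lra.
  assert (H3 : exp x * (1 - x) <= 1).
  { pose proof (exp_pos x) as H3.
    apply Rle_trans with (exp x * / exp x); [apply Rmult_le_compat_l; lra|].
    right; apply Rinv_r; lra. }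
  enough (exp x <= 1 + x + 2 * x ^ 2) by lra.
  apply Rmult_le_reg_r with (1 - x); nra.
Qed.

Lemma Rabs_sin_le (y : R) : Rabs (sin y) <= Rabs y.
Proof.
  destruct (MVT_abs sin cos 0 y) as [c [H _]].
  - intros c _; apply derivable_pt_lim_sin.
  - rewrite sin_0, !Rminus_0_r in H; rewrite H.
    pose proof (COS_bound c); pose proof (Rabs_pos y).
    assert (Rabs (cos c) <= 1) by (apply Rabs_le; lra); nra.
Qed.

(** Half-angle formula: 1 - cos y = 2 sin^2 (y / 2). *)
Lemma Rabs_cos_taylor (y : R) : Rabs (cos y - 1) <= y ^ 2 / 2.
Proof.
  replace (cos y) with (1 - 2 * sin (y / 2) * sin (y / 2))
    by (rewrite <- cos_2a_sin; f_equal; field).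
  pose proof (Rabs_sin_le (y / 2)) as H; apply Rsqr_le_abs_1 in H.
  unfold Rsqr in H; rewrite Rabs_minus_sym, Rabs_pos_eq; nra.
Qed.

(** Mean value theorem for sin y - y, whose derivative cos c - 1 is at most c^2 / 2 <= |y| in
    absolute value. *)
Lemma Rabs_sin_taylor (y : R) : Rabs y <= 1 -> Rabs (sin y - y) <= y ^ 2.
Proof.
  intros Hy.
  destruct (MVT_abs (fun y => sin y - y) (fun y => cos y - 1) 0 y) as [c [H Hc]].
  - intros c _; apply (derivable_pt_lim_minus sin id);
      [apply derivable_pt_lim_sin | apply derivable_pt_lim_id].
  - rewrite sin_0, !Rminus_0_r in H; rewrite H.
    assert (Hcy : Rabs c <= Rabs y).
    { unfold Rmin, Rmax in Hc; destruct (Rle_dec 0 y); unfold Rabs;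
        destruct (Rcase_abs c), (Rcase_abs y); lra. }
    pose proof (Rabs_cos_taylor c); pose proof (Rabs_pos y); pose proof (Rabs_pos c).
    rewrite <- (pow2_abs c) in *; rewrite <- (pow2_abs y).
    assert (Rabs (cos c - 1) <= Rabs y) by nra; nra.
Qed.

Lemma Cmod_le_Rabs (z : C) : Cmod z <= Rabs (fst z) + Rabs (snd z).
Proof.
  destruct z as [x y]; cbn [fst snd].
  replace (x, y) with (RtoC x + Ci * RtoC y)%C
    by (unfold Cplus, Cmult, RtoC, Ci; simpl; f_equal; ring).
  eapply Rle_trans; [apply Cmod_triangle|].
  rewrite Cmod_mult, Cmod_Ci, !Cmod_R, Rmult_1_l; apply Rle_refl.
Qed.

Lemma Cmod_Cexp_taylor (w : C) :
  Cmod w <= / 2 -> Cmod (Cexp w - 1 - w)%C <= 3 * Cmod w ^ 2.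
Proof.
  intros H; pose proof (Rmax_Cmod w) as Hm.
  rewrite Cmod2_alt; destruct w as [x y]; unfold Re, Im; cbn [fst snd] in *.
  assert (Hx : Rabs x <= / 2) by (pose proof (Rmax_l (Rabs x) (Rabs y)); lra).
  assert (Hy : Rabs y <= / 2) by (pose proof (Rmax_r (Rabs x) (Rabs y)); lra).
  pose proof (Rabs_exp_taylor x Hx) as E; pose proof (Rabs_cos_taylor y) as Co.
  pose proof (Rabs_sin_taylor y ltac:(lra)) as S; pose proof (Rabs_sin_le y) as S'.
  assert (E2 : exp x <= 2).
  { apply Rabs_le_between in E; apply Rabs_le_between in Hx; nra. }
  assert (E1 : Rabs (exp x - 1) <= 2 * Rabs x).
  { replace (exp x - 1) with ((exp x - 1 - x) + x) by ring.
    eapply Rle_trans; [apply Rabs_triang|].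
    rewrite <- (pow2_abs x) in E; pose proof (Rabs_pos x).
    assert (2 * Rabs x ^ 2 <= Rabs x) by nra; lra. }
  set (u := (Cexp _ - _ - _)%C).
  eapply Rle_trans; [apply Cmod_le_Rabs|].
  (* The remainder is split so that each summand is quadratic; the four bounds 2 x^2, y^2, x^2 + y^2
     and y^2 add up to 3 |w|^2. *)
  replace (fst u) with ((exp x - 1 - x) + exp x * (cos y - 1)) by (simpl; ring).
  replace (snd u) with ((exp x - 1) * sin y + (sin y - y)) by (simpl; ring).
  pose proof (Rabs_triang (exp x - 1 - x) (exp x * (cos y - 1))) as T1.
  pose proof (Rabs_triang ((exp x - 1) * sin y) (sin y - y)) as T2.
  rewrite Rabs_mult in T1, T2; rewrite (Rabs_pos_eq (exp x)) in T1
    by (left; apply exp_pos).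
  assert (M1 : exp x * Rabs (cos y - 1) <= y ^ 2).
  { replace (y ^ 2) with (2 * (y ^ 2 / 2)) by field.
    apply Rmult_le_compat; auto using Rabs_pos; left; apply exp_pos. }
  assert (M2 : Rabs (exp x - 1) * Rabs (sin y) <= 2 * Rabs x * Rabs y).
  { apply Rmult_le_compat; auto using Rabs_pos. }
  assert (M3 : 2 * Rabs x * Rabs y <= x ^ 2 + y ^ 2).
  { rewrite <- (pow2_abs x), <- (pow2_abs y).
    pose proof (pow2_ge_0 (Rabs x - Rabs y)); lra. }
  lra.
Qed.

(** * Limits of complex sequences *)

(** Phrased through the modulus, so that convergence proofs reduce to inequalities between real
    sequences. *)
Definition Clim (u : nat -> C) (l : C) : Prop :=
  is_lim_seq (fun n => Cmod (u n - l)%C) 0.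

Lemma Clim_filterlim (u : nat -> C) (l : C) :
  Clim u l <-> filterlim u eventually (locally (T := C_UniformSpace) l).
Proof.
  unfold Clim; rewrite <- is_lim_seq_spec; simpl; split; intros H.
  - apply filterlim_locally; intros eps.
    destruct (H eps) as [N HN]; exists N; intros n Hn; specialize (HN n Hn).
    rewrite Rminus_0_r, Rabs_pos_eq in HN by apply Cmod_ge_0.
    apply C_NormedModule_mixin_compat1; exact HN.
  - intros eps.
    (* Balls of [C_UniformSpace] are products of real balls; the modulus exceeds their radius by a
       factor of at most sqrt 2. *)
    assert (Hs : 0 < sqrt 2) by (apply sqrt_lt_R0; lra).
    assert (Hd : 0 < eps / sqrt 2)
      by (apply Rdiv_lt_0_compat; [apply cond_pos | exact Hs]).
    pose proof (proj1 (filterlim_locally u l) H (mkposreal _ Hd)) as [N HN].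
    exists N; intros n Hn; specialize (HN n Hn).
    apply C_NormedModule_mixin_compat2 in HN; simpl in HN.
    rewrite Rminus_0_r, Rabs_pos_eq by apply Cmod_ge_0.
    replace (pos eps) with (sqrt 2 * (eps / sqrt 2)) by (field; lra); exact HN.
Qed.

Lemma is_lim_seq_squeeze0 (u v : nat -> R) :
  (exists N, forall n, (N <= n)%nat -> 0 <= u n <= v n) ->
  is_lim_seq v 0 -> is_lim_seq u 0.
Proof.
  intros [N H] Hv; apply (is_lim_seq_le_le_loc (fun _ => 0) u v).
  - exists N; exact H.
  - apply is_lim_seq_const.
  - exact Hv.
Qed.

Lemma Clim_Cauchy (u : nat -> C) (d : nat -> R) (N : nat) :
  (forall p q, (N <= q)%nat -> (q <= p)%nat -> Cmod (u p - u q)%C <= d q) ->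
  is_lim_seq d 0 -> exists l, Clim u l.
Proof.
  intros H Hd.
  assert (HC : exists l, filterlim u eventually (locally (T := C_UniformSpace) l)).
  { apply (filterlim_locally_cauchy (U := C_CompleteNormedModule)).
    intros eps.
    apply is_lim_seq_spec in Hd; destruct (Hd (pos_div_2 eps)) as [M HM]; simpl in HM.
    exists (fun n => (max N M <= n)%nat); split; [exists (max N M); auto|].
    intros p q Hp Hq; apply C_NormedModule_mixin_compat1.
    specialize (HM (max N M) ltac:(lia)); rewrite Rminus_0_r in HM.
    apply Rabs_def2 in HM; destruct HM as [HM _].
    pose proof (H p (max N M) ltac:(lia) ltac:(lia)) as H1.
    pose proof (H q (max N M) ltac:(lia) ltac:(lia)) as H2.
    change (minus (u q) (u p)) with (u q - u p)%C.
    replace (u q - u p)%C with ((u q - u (max N M)) + - (u p - u (max N M)))%C by ring.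
    eapply Rle_lt_trans; [apply Cmod_triangle|]; rewrite Cmod_opp; lra. }
  destruct HC as [l Hl]; exists l; apply Clim_filterlim; exact Hl.
Qed.

(** In effect the convergence of an infinite product with factors 1 + e_n, where |e_n| <=
    [d n - d (S n)]. The telescoping sum of these bounds first keeps [a] bounded, then makes its
    increments summable, with [B * d q] controlling the tail. *)
Lemma Clim_multiplicative_increments (a : nat -> C) (d : nat -> R) (N : nat) :
  (forall n, (N <= n)%nat -> 0 <= d (S n) <= d n) ->
  is_lim_seq d 0 ->
  (forall n, (N <= n)%nat -> Cmod (a (S n) - a n)%C <= (d n - d (S n)) * Cmod (a n)) ->
  exists l, Clim a l.
Proof.
  intros Hpos Hd H.
  (* [Cmod (a n) * exp (d n)] is nonincreasing *)
  assert (Hb : forall n, (N <= n)%nat -> Cmod (a n) * exp (d n) <= Cmod (a N) * exp (d N)).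
  { intros n Hn; induction Hn as [|n Hn IH]; [lra|].
    eapply Rle_trans; [|exact IH].
    replace (exp (d n)) with (exp (d n - d (S n)) * exp (d (S n)))
      by (rewrite <- exp_plus; f_equal; ring).
    rewrite <- Rmult_assoc; apply Rmult_le_compat_r; [left; apply exp_pos|].
    replace (a (S n)) with (a n + (a (S n) - a n))%C by ring.
    eapply Rle_trans; [apply Cmod_triangle|].
    pose proof (H n Hn); pose proof (exp_ineq1_le (d n - d (S n))).
    pose proof (Cmod_ge_0 (a n)); nra. }
  set (B := Cmod (a N) * exp (d N)) in *.
  assert (HB : forall n, (N <= n)%nat -> Cmod (a n) <= B).
  { intros n Hn; eapply Rle_trans; [|exact (Hb n Hn)].
    pose proof (exp_ineq1_le (d n)); pose proof (Hpos n Hn).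
    pose proof (Cmod_ge_0 (a n)); nra. }
  assert (B0 : 0 <= B) by (eapply Rle_trans; [apply Cmod_ge_0|apply (HB N); lia]).
  assert (Hmon : forall n, (N <= n)%nat ->
                   Cmod (a (S n) - a n)%C <= (d n - d (S n)) * B).
  { intros n Hn; pose proof (H n Hn) as H1; pose proof (HB n Hn) as H2.
    pose proof (Cmod_ge_0 (a (S n) - a n)%C); pose proof (Cmod_ge_0 (a n)).
    pose proof (Hpos n Hn); nra. }
  apply (Clim_Cauchy a (fun n => B * d n) N).
  - intros p q Hq Hp.
    assert (Hpq : Cmod (a p - a q)%C <= (d q - d p) * B).
    { induction Hp as [|p Hp IH].
      - replace (a q - a q)%C with (RtoC 0) by ring; rewrite Cmod_0; lra.
      - replace (a (S p) - a q)%C with ((a (S p) - a p) + (a p - a q))%C by ring.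
        eapply Rle_trans; [apply Cmod_triangle|].
        pose proof (Hmon p ltac:(lia)); lra. }
    pose proof (Hpos p ltac:(lia)); nra.
  - replace (Finite 0) with (Rbar_mult B 0) by (simpl; f_equal; ring).
    apply is_lim_seq_scal_l; exact Hd.
Qed.

Lemma RtoC_neq0 (x : R) : x <> 0 -> RtoC x <> RtoC 0.
Proof. intros H E; apply H, RtoC_inj, E. Qed.

(** * The reciprocal Gamma function *)

Definition gauss_rGamma (z : C) (n : nat) : C :=
  (Crising z (S n) / (RtoC (INR (fact n)) * Cexp (z * RtoC (ln (INR n)))))%C.

Lemma gauss_rGamma_S (z : C) (n : nat) :
  gauss_rGamma z (S n) =
  (gauss_rGamma z n
   * ((1 + z * RtoC (/ INR (S n))) * Cexp (- (z * RtoC (ln (INR (S n)) - ln (INR n))))))%C.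
Proof.
  unfold gauss_rGamma.
  rewrite fact_simpl, mult_INR, RtoC_mult.
  change (Crising z (S (S n))) with (Crising z (S n) * (z + RtoC (INR (S n))))%C.
  (* At n = 0 the logarithm [ln (INR n)] is a default value; treated as an arbitrary [l], it
     cancels. *)
  set (l := ln (INR n)); set (l' := ln (INR (S n))).
  replace (Cexp (z * RtoC l')) with (Cexp (z * RtoC l) * Cexp (z * RtoC (l' - l)))%C
    by (rewrite <- Cexp_plus, RtoC_minus; f_equal; ring).
  assert (E : (Cexp (- (z * RtoC (l' - l))) * Cexp (z * RtoC (l' - l)))%C = RtoC 1)
    by (rewrite <- Cexp_plus, <- Cexp_0; f_equal; ring).
  assert (HS : RtoC (INR (S n)) <> RtoC 0) by (apply RtoC_neq0, not_0_INR; lia).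
  assert (HF : RtoC (INR (fact n)) <> RtoC 0) by apply RtoC_neq0, INR_fact_neq_0.
  rewrite RtoC_inv by (apply not_0_INR; lia).
  set (y := Cexp (- _)) in *; set (x := Cexp (z * RtoC (l' - l))) in *.
  assert (Hx : x <> RtoC 0) by apply Cexp_neq0.
  replace y with (/ x)%C
    by (transitivity ((y * x) / x)%C; [rewrite E|]; field; exact Hx).
  field; repeat split; auto using Cexp_neq0.
Qed.

Lemma ln_S_bounds (n : nat) : (1 <= n)%nat ->
  / INR (S n) <= ln (INR (S n)) - ln (INR n) <= / INR n.
Proof.
  intros Hn; apply le_INR in Hn; simpl (INR 1) in Hn; rewrite S_INR.
  set (x := INR n) in *.
  (* The inequality ln y <= y - 1 at y = b / a, used for n and n + 1 in both orders. *)
  assert (H : forall a b, 0 < a -> 0 < b -> ln b - ln a <= b / a - 1).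
  { intros a b Ha Hb; rewrite <- ln_div by assumption.
    rewrite <- (ln_exp (b / a - 1)); apply ln_le; [apply Rdiv_lt_0_compat; assumption|].
    pose proof (exp_ineq1_le (b / a - 1)); lra. }
  split.
  - pose proof (H (x + 1) x ltac:(lra) ltac:(lra)) as H1.
    replace (x / (x + 1) - 1) with (- / (x + 1)) in H1 by (field; lra); lra.
  - pose proof (H x (x + 1) ltac:(lra) ltac:(lra)) as H1.
    replace ((x + 1) / x - 1) with (/ x) in H1 by (field; lra); lra.
Qed.

(** Meant for u = 1 / (n + 1), t = ln (n + 1) - ln n and e = 1 / n. The first-order terms z u and -
    z t cancel up to z (u - t), which is O(e^2) like the cross term and the Taylor remainder [r] of
    the exponential. *)
Lemma gauss_factor_bound (z : C) (u t e : R) :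
  0 <= u -> u <= t -> t <= e -> e <= 1 -> t - u <= e ^ 2 -> Cmod z * e <= / 2 ->
  Cmod ((1 + z * RtoC u) * Cexp (- (z * RtoC t)) - 1)%C
  <= (Cmod z + Cmod z ^ 2 + 3 * Cmod z ^ 2 * (1 + Cmod z)) * e ^ 2.
Proof.
  intros Hu Hut Hte He Htu Hz.
  set (r := (Cexp (- (z * RtoC t)) - 1 - - (z * RtoC t))%C).
  replace (Cexp (- (z * RtoC t)))%C with (1 + - (z * RtoC t) + r)%C
    by (unfold r; ring).
  set (m := Cmod z) in *; assert (Hm : 0 <= m) by apply Cmod_ge_0.
  assert (Hzt : Cmod (- (z * RtoC t))%C = m * t)
    by (rewrite Cmod_opp, Cmod_mult, Cmod_R, Rabs_pos_eq; [reflexivity|lra]).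
  assert (Hzt' : m * t <= m * e) by (apply Rmult_le_compat_l; lra).
  assert (Hr : Cmod r <= 3 * (m * e) ^ 2).
  { eapply Rle_trans; [apply Cmod_Cexp_taylor; rewrite Hzt; lra|rewrite Hzt].
    apply Rmult_le_compat_l; [lra|]; apply pow_incr; nra. }
  replace ((1 + z * RtoC u) * (1 + - (z * RtoC t) + r) - 1)%C
    with (z * (RtoC u - RtoC t) + (- (z * z * (RtoC t * RtoC u)) + (1 + z * RtoC u) * r))%C
    by ring.
  rewrite <- RtoC_minus, <- RtoC_mult.
  eapply Rle_trans; [apply Cmod_triangle|].
  assert (H1 : Cmod (z * RtoC (u - t))%C <= m * e ^ 2).
  { rewrite Cmod_mult, Cmod_R, Rabs_left1 by lra; apply Rmult_le_compat_l; lra. }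
  assert (H2 : Cmod (- (z * z * RtoC (t * u)))%C <= m ^ 2 * e ^ 2).
  { rewrite Cmod_opp, !Cmod_mult, Cmod_R, Rabs_pos_eq by nra.
    fold m; replace (m ^ 2) with (m * m) by ring.
    apply Rmult_le_compat_l; nra. }
  assert (H3 : Cmod (1 + z * RtoC u)%C <= 1 + m).
  { eapply Rle_trans; [apply Cmod_triangle|].
    rewrite Cmod_1, Cmod_mult, Cmod_R, Rabs_pos_eq by lra; fold m; nra. }
  assert (H4 : Cmod ((1 + z * RtoC u) * r)%C <= (1 + m) * (3 * (m * e) ^ 2)).
  { rewrite Cmod_mult; apply Rmult_le_compat; auto using Cmod_ge_0. }
  pose proof (Cmod_triangle (- (z * z * RtoC (t * u))) ((1 + z * RtoC u) * r)).
  lra.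
Qed.

Lemma is_lim_seq_div_INR (K : R) : is_lim_seq (fun n => K / INR n) 0.
Proof.
  unfold Rdiv; replace (Finite 0) with (Rbar_mult K 0) by (simpl; f_equal; ring).
  apply is_lim_seq_scal_l.
  change (Finite 0) with (Rbar_inv p_infty).
  apply is_lim_seq_inv; [apply is_lim_seq_INR | discriminate].
Qed.

Lemma Clim_gauss_rGamma_ex (z : C) : exists l, Clim (gauss_rGamma z) l.
Proof.
  set (K := Cmod z + Cmod z ^ 2 + 3 * Cmod z ^ 2 * (1 + Cmod z)).
  assert (HK : 0 <= K) by (unfold K; pose proof (Cmod_ge_0 z); nra).
  (* For n >= N + 1 one has 2 |z| <= n, hence |z| / n <= 1 / 2, as the bound on the factor
     requires. *)
  destruct (nfloor_ex (2 * Cmod z)) as [N [_ HN]];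
    [pose proof (Cmod_ge_0 z); lra|].
  (* 1 / n^2 <= 2 (1 / n - 1 / (n + 1)) makes the increments telescope *)
  apply (Clim_multiplicative_increments _ (fun n => 2 * K / INR n) (S N)).
  - intros n Hn.
    assert (Hn1 : 1 <= INR n) by (apply (le_INR 1); lia).
    rewrite S_INR; split.
    + apply Rle_mult_inv_pos; lra.
    + unfold Rdiv; apply Rmult_le_compat_l; [lra|]; apply Rinv_le_contravar; lra.
  - apply is_lim_seq_div_INR.
  - intros n Hn.
    assert (Hn1 : 1 <= INR n) by (apply (le_INR 1); lia).
    assert (Hn2 : 2 * Cmod z <= INR n).
    { apply le_INR in Hn; rewrite S_INR in Hn; lra. }
    rewrite gauss_rGamma_S; set (q := (_ * Cexp _)%C).
    replace (gauss_rGamma z n * q - gauss_rGamma z n)%C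
      with (gauss_rGamma z n * (q - 1))%C by ring.
    rewrite Cmod_mult, Rmult_comm; apply Rmult_le_compat_r; [apply Cmod_ge_0|].
    destruct (ln_S_bounds n ltac:(lia)) as [L1 L2].
    assert (E : / INR n - / INR (S n) = / (INR n * (INR n + 1)))
      by (rewrite S_INR; field; lra).
    assert (E1 : / (INR n * (INR n + 1)) <= (/ INR n) ^ 2).
    { rewrite pow_inv; apply Rinv_le_contravar; nra. }
    assert (E2 : (/ INR n) ^ 2 <= 2 * / (INR n * (INR n + 1))).
    { replace ((/ INR n) ^ 2) with (2 * / (2 * INR n ^ 2)) by (field; lra).
      apply Rmult_le_compat_l; [lra|]; apply Rinv_le_contravar; nra. }
    eapply Rle_trans; [apply (gauss_factor_bound z _ _ (/ INR n))|].
    + left; apply Rinv_0_lt_compat; rewrite S_INR; lra.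
    + exact L1.
    + exact L2.
    + rewrite <- Rinv_1; apply Rinv_le_contravar; lra.
    + lra.
    + apply Rmult_le_reg_r with (INR n); [lra|].
      rewrite Rmult_assoc, Rinv_l; lra.
    + fold K; replace (2 * K / INR n - 2 * K / INR (S n))
        with (K * (2 * (/ INR n - / INR (S n)))) by (rewrite S_INR; field; lra).
      rewrite E; apply Rmult_le_compat_l; lra.
Qed.

(** Existence of the limit is what makes the [iota] in [rGamma] select it. *)
Lemma Clim_rGamma (z : C) : Clim (gauss_rGamma z) (rGamma z).
Proof.
  destruct (Clim_gauss_rGamma_ex z) as [l Hl].
  replace (rGamma z) with l; [exact Hl|].
  symmetry; apply (iota_filterlim_locally (V := C_CompleteNormedModule)
    (F := eventually) (gauss_rGamma z)), Clim_filterlim, Hl.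
Qed.

Lemma Clim_unique (u : nat -> C) (l l' : C) : Clim u l -> Clim u l' -> l = l'.
Proof.
  intros H H'; apply (filterlim_locally_unique (V := C_NormedModule) (F := eventually) u);
    apply Clim_filterlim; assumption.
Qed.

Lemma Crising_S_l (z : C) (n : nat) : Crising z (S n) = (z * Crising (z + 1) n)%C.
Proof.
  induction n as [|n IH]; [simpl; ring|].
  change (Crising z (S (S n))) with (Crising z (S n) * (z + RtoC (INR (S n))))%C.
  rewrite IH, S_INR, RtoC_plus; simpl; ring.
Qed.

(** Gauss' sequences satisfy z g_n(z + 1) = g_n(z) (1 + (z + 1) / n) for n >= 1, and the last factor
    tends to 1; thus g_n(z) converges to both sides. *)
Lemma rGamma_rec (z : C) : rGamma z = (z * rGamma (z + 1))%C.
Proof.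
  apply (Clim_unique (gauss_rGamma z)); [apply Clim_rGamma|].
  pose proof (Clim_rGamma z) as H; pose proof (Clim_rGamma (z + 1)%C) as H1.
  unfold Clim in *.
  set (u := fun n => Cmod (gauss_rGamma z n - rGamma z)%C) in H.
  set (v := fun n => Cmod (gauss_rGamma (z + 1) n - rGamma (z + 1))%C) in H1.
  (* The majorant combines the error at z + 1, scaled by |z|, with |g_n(z)| |z + 1| / n, where
     |g_n(z)| is at most its error plus the modulus of its limit. *)
  apply (is_lim_seq_squeeze0 _ (fun n => Cmod z * v n
    + (u n + Cmod (rGamma z)) * (Cmod (z + 1) / INR n))).
  - exists 1%nat; intros n Hn; split; [apply Cmod_ge_0|].
    assert (Hn1 : 1 <= INR n) by (apply (le_INR 1); lia).
    assert (E : (z * gauss_rGamma (z + 1) n)%C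
                = (gauss_rGamma z n * (1 + (z + 1) / RtoC (INR n)))%C).
    { unfold gauss_rGamma; rewrite (Crising_S_l z n).
      replace (Cexp ((z + 1) * RtoC (ln (INR n))))%C
        with (Cexp (z * RtoC (ln (INR n))) * RtoC (INR n))%C.
      - change (Crising (z + 1) (S n))
          with (Crising (z + 1) n * (z + 1 + RtoC (INR n)))%C.
        field; repeat split; try apply RtoC_neq0; auto using Cexp_neq0, INR_fact_neq_0.
        lra.
      - rewrite Cmult_plus_distr_r, Cexp_plus, Cmult_1_l, Cexp_RtoC, exp_ln by lra.
        reflexivity. }
    replace (gauss_rGamma z n - z * rGamma (z + 1))%C
      with (z * (gauss_rGamma (z + 1) n - rGamma (z + 1))
            + - (((gauss_rGamma z n - rGamma z) + rGamma z) * ((z + 1) / RtoC (INR n))))%C.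
    + eapply Rle_trans; [apply Cmod_triangle|].
      rewrite Cmod_opp, !Cmod_mult, Cmod_div, Cmod_R, Rabs_pos_eq
        by (try apply RtoC_neq0; lra).
      apply Rplus_le_compat; [apply Rle_refl|].
      apply Rmult_le_compat_r; [|apply Cmod_triangle].
      apply Rle_mult_inv_pos; [apply Cmod_ge_0|lra].
    + transitivity (z * gauss_rGamma (z + 1) n - z * rGamma (z + 1)
        - gauss_rGamma z n * ((z + 1) / RtoC (INR n)))%C; [ring|].
      rewrite E; ring.
  - replace (Finite 0) with (Finite (Cmod z * 0 + (0 + Cmod (rGamma z)) * 0))
      by (f_equal; ring).
    apply is_lim_seq_plus'.
    + apply is_lim_seq_mult'; [apply is_lim_seq_const | exact H1].
    + apply is_lim_seq_mult'.
      * apply is_lim_seq_plus'; [exact H | apply is_lim_seq_const].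
      * apply is_lim_seq_div_INR.
Qed.

(** * Entire power series *)

Definition Cis_series (a : nat -> C) (l : C) : Prop := is_series (V := C_NormedModule) a l.

Definition Csum (a : nat -> C) : C := epsilon (inhabits (RtoC 0)) (Cis_series a).

Lemma Cis_series_unique (a : nat -> C) (l l' : C) :
  Cis_series a l -> Cis_series a l' -> l = l'.
Proof. apply (filterlim_locally_unique (V := C_NormedModule) (F := eventually)). Qed.

Lemma Csum_correct (a : nat -> C) : ex_series (fun n => Cmod (a n)) -> Cis_series a (Csum a).
Proof.
  intros H; unfold Csum; apply epsilon_spec.
  apply (ex_series_le (V := C_CompleteNormedModule) a (fun n => Cmod (a n)));
    [|exact H].
  intros n; apply Rle_refl.
Qed.

Lemma Cis_series_scal (c : C) (a : nat -> C) (l : C) :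
  Cis_series a l -> Cis_series (fun n => c * a n)%C (c * l)%C.
Proof. apply (is_series_scal (V := C_NormedModule) c). Qed.

Lemma Cis_series_plus (a b : nat -> C) (l m : C) :
  Cis_series a l -> Cis_series b m -> Cis_series (fun n => a n + b n)%C (l + m)%C.
Proof. apply (is_series_plus (V := C_NormedModule)). Qed.

Lemma Cis_series_ext (a b : nat -> C) (l : C) :
  (forall n, a n = b n) -> Cis_series a l -> Cis_series b l.
Proof. apply (is_series_ext (V := C_NormedModule)). Qed.

Lemma Cis_series_shift (a : nat -> C) (l : C) :
  Cis_series (fun n => a (S n)) (l - a 0%nat)%C <-> Cis_series a l.
Proof.
  split; intros H.
  - apply (is_series_decr_1 (V := C_NormedModule)); exact H.
  - apply (is_series_incr_1 (V := C_NormedModule)); unfold Cis_series in H.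
    change (is_series (V := C_NormedModule) a ((l - a 0%nat) + a 0%nat)%C).
    replace ((l - a 0%nat) + a 0%nat)%C with l by ring; exact H.
Qed.

Lemma Cmod_series_le (a : nat -> C) (b : nat -> R) (l : C) (m : R) :
  Cis_series a l -> is_series b m -> (forall n, Cmod (a n) <= b n) -> Cmod l <= m.
Proof.
  intros Ha Hb H.
  assert (Hs : forall n, Cmod (sum_n (G := C_NormedModule) a n) <= sum_n b n).
  { induction n as [|n IH]; [rewrite !sum_O; apply H|].
    rewrite !sum_Sn; eapply Rle_trans; [apply Cmod_triangle|].
    apply Rplus_le_compat; [exact IH | apply H]. }
  apply Clim_filterlim in Ha.
  (* Since |l| - |s_n - l| <= |s_n|, the left sequence lies below the real partial sums and tends to
     |l|. *)
  apply (is_lim_seq_le (fun n => Cmod l - Cmod (sum_n (G := C_NormedModule) a n - l)%C)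
           (sum_n b) (Finite (Cmod l)) m).
  - intros n; eapply Rle_trans; [|apply Hs].
    set (s := sum_n _ n).
    replace l with (s + - (s - l))%C at 1 by ring.
    pose proof (Cmod_triangle s (- (s - l))) as T; rewrite Cmod_opp in T; lra.
  - replace (Finite (Cmod l)) with (Finite (Cmod l - 0)) by (f_equal; ring).
    apply is_lim_seq_minus'; [apply is_lim_seq_const | exact Ha].
  - exact Hb.
Qed.

Definition entire_coeffs (c : nat -> C) : Prop :=
  forall r, 0 <= r -> ex_series (fun n => Cmod (c n) * r ^ n).

Definition Cpser (c : nat -> C) (w : C) : C := Csum (fun n => c n * w ^ n)%C.

Definition Cpser_deriv (c : nat -> C) (n : nat) : C := (RtoC (INR (S n)) * c (S n))%C.

Lemma INR_le_pow2 (n : nat) : INR n <= 2 ^ n.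
Proof.
  induction n as [|n IH]; [simpl; lra|].
  rewrite S_INR; simpl; pose proof (pow_R1_Rle 2 n ltac:(lra)); lra.
Qed.

(** The factor n + 1 is absorbed by 2^(n + 1), so the series of c at radius 2 (r + 1) dominates;
    adding 1 to r makes the base at least 1, so that r^n <= (r + 1)^(n + 1). *)
Lemma entire_coeffs_deriv (c : nat -> C) :
  entire_coeffs c -> entire_coeffs (Cpser_deriv c).
Proof.
  intros H r Hr.
  pose proof (H (2 * (r + 1)) ltac:(lra)) as H1; apply ex_series_incr_1 in H1.
  apply (ex_series_le (V := R_CompleteNormedModule)) with (2 := H1); intros n.
  change (Rabs (Cmod (Cpser_deriv c n) * r ^ n)
          <= Cmod (c (S n)) * (2 * (r + 1)) ^ S n).
  pose proof (Cmod_ge_0 (c (S n))) as Hc; pose proof (pow_le r n Hr) as Hp.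
  pose proof (pos_INR (S n)) as Hn; pose proof (INR_le_pow2 (S n)).
  unfold Cpser_deriv; rewrite Cmod_mult, Cmod_R, Rpow_mult_distr.
  rewrite (Rabs_pos_eq (INR _)) by exact Hn.
  rewrite Rabs_pos_eq by (repeat apply Rmult_le_pos; assumption).
  replace (INR (S n) * Cmod (c (S n)) * r ^ n)
    with (Cmod (c (S n)) * (INR (S n) * r ^ n)) by ring.
  apply Rmult_le_compat_l; [exact Hc|]; apply Rmult_le_compat; try assumption.
  apply Rle_trans with ((r + 1) ^ n); [apply pow_incr; lra|].
  apply Rle_pow; [lra|lia].
Qed.

Lemma Cpser_correct (c : nat -> C) (w : C) :
  entire_coeffs c -> Cis_series (fun n => c n * w ^ n)%C (Cpser c w).
Proof.
  intros H; apply Csum_correct.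
  apply (ex_series_ext (fun n => Cmod (c n) * Cmod w ^ n)).
  - intros n; rewrite Cmod_mult, Cmod_pow; reflexivity.
  - apply H, Cmod_ge_0.
Qed.

(** By induction: the next remainder is (w + h) D + (n + 1) w^n h^2, and each summand is at most
    half of the next bound. The crude geometric growth is harmless against the coefficients of an
    entire series. *)
Lemma Cmod_pow_taylor (w h : C) (n : nat) : Cmod h <= 1 ->
  Cmod ((w + h) ^ S n - w ^ S n - RtoC (INR (S n)) * w ^ n * h)%C
  <= Cmod h ^ 2 * (2 * (Cmod w + 1)) ^ S n.
Proof.
  intros Hh; pose proof (Cmod_ge_0 h) as Hh0; pose proof (Cmod_ge_0 w) as Hw0.
  induction n as [|n IH].
  - replace ((w + h) ^ 1 - w ^ 1 - RtoC (INR 1) * w ^ 0 * h)%C with (RtoC 0)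
      by (simpl; ring).
    rewrite Cmod_0; apply Rmult_le_pos; [nra|]; apply pow_le; lra.
  - set (D := (_ - RtoC (INR (S n)) * _ * _)%C) in IH.
    replace ((w + h) ^ S (S n) - w ^ S (S n) - RtoC (INR (S (S n))) * w ^ S n * h)%C
      with ((w + h) * D + RtoC (INR (S n)) * w ^ n * (h * h))%C
      by (unfold D; rewrite !S_INR, !RtoC_plus; simpl; ring).
    eapply Rle_trans; [apply Cmod_triangle|].
    rewrite !Cmod_mult, Cmod_R, (Rabs_pos_eq (INR _)), Cmod_pow by apply pos_INR.
    assert (H1 : Cmod (w + h) <= Cmod w + 1)
      by (eapply Rle_trans; [apply Cmod_triangle|]; lra).
    set (q := Cmod w + 1) in *; set (X := Cmod h ^ 2 * (2 * q) ^ S n) in *.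
    assert (H2 : Cmod (w + h) * Cmod D <= q * X)
      by (apply Rmult_le_compat; auto using Cmod_ge_0).
    assert (H3 : INR (S n) * Cmod w ^ n * (Cmod h * Cmod h) <= q * X).
    { replace (q * X) with ((2 ^ S n * q ^ S (S n)) * (Cmod h * Cmod h))
        by (unfold X; rewrite Rpow_mult_distr; simpl; ring).
      apply Rmult_le_compat_r; [nra|].
      apply Rmult_le_compat; [apply pos_INR | apply pow_le, Hw0 | apply INR_le_pow2 |].
      apply Rle_trans with (q ^ n); [apply pow_incr; unfold q; lra|].
      apply Rle_pow; [unfold q; lra|lia]. }
    replace (Cmod h ^ 2 * (2 * q) ^ S (S n)) with (2 * (q * X))
      by (unfold X; simpl; ring).
    lra.
Qed.

(** * Complex derivatives *)

Definition Cderiv (f : C -> C) (z l : C) : Prop :=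
  is_derive (K := C_AbsRing) (V := C_NormedModule) f z l.

(** The source of the differential carries the modulus balls of [C_AbsRing], so no factor sqrt 2
    appears. *)
Lemma Cderiv_eps (f : C -> C) (z l : C) :
  Cderiv f z l <->
  forall eps : posreal, exists d : posreal, forall h, Cmod h < d ->
    Cmod (f (z + h) - f z - h * l)%C <= eps * Cmod h.
Proof.
  unfold Cderiv, is_derive, filterdiff; split.
  - intros [_ H] eps; specialize (H z (fun P H => H) eps).
    destruct H as [d Hd]; exists d; intros h Hh.
    specialize (Hd (z + h)%C).
    change (minus (z + h)%C z) with (z + h - z)%C in Hd.
    replace (z + h - z)%C with h in Hd by ring.
    apply Hd; unfold ball; simpl; unfold AbsRing_ball; simpl.
    change (minus (z + h)%C z) with (z + h - z)%C.
    replace (z + h - z)%C with h by ring; exact Hh.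
  - intros H; split; [apply is_linear_scal_l|].
    intros x Hx eps.
    apply (is_filter_lim_locally_unique (V := AbsRing_NormedModule C_AbsRing)) in Hx.
    subst x.
    destruct (H eps) as [d Hd]; exists d; intros y Hy.
    specialize (Hd (y - z)%C Hy).
    assert (E : (z + (y - z))%C = y) by ring; rewrite E in Hd; exact Hd.
Qed.

Lemma Cderiv_quadratic (f : C -> C) (z l : C) (M r : R) : 0 < r ->
  (forall h, Cmod h <= r -> Cmod (f (z + h) - f z - h * l)%C <= M * Cmod h ^ 2) ->
  Cderiv f z l.
Proof.
  intros Hr H; apply Cderiv_eps; intros eps.
  pose proof (cond_pos eps) as He; pose proof (Rabs_pos M) as HM0.
  (* Since [M] may have any sign or vanish, |M| + 1 serves as a positive upper bound. *)
  assert (Hd : 0 < Rmin r (eps / (Rabs M + 1)))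
    by (apply Rmin_pos; [exact Hr|]; apply Rdiv_lt_0_compat; lra).
  exists (mkposreal _ Hd); intros h Hh; simpl in Hh.
  pose proof (Rmin_l r (eps / (Rabs M + 1))); pose proof (Rmin_r r (eps / (Rabs M + 1))).
  eapply Rle_trans; [apply H; lra|].
  replace (M * Cmod h ^ 2) with ((M * Cmod h) * Cmod h) by ring.
  apply Rmult_le_compat_r; [apply Cmod_ge_0|].
  apply Rle_trans with ((Rabs M + 1) * (eps / (Rabs M + 1))); [|right; field; lra].
  pose proof (Cmod_ge_0 h); pose proof (Rle_abs M).
  apply Rle_trans with ((Rabs M + 1) * Cmod h); [nra|].
  apply Rmult_le_compat_l; lra.
Qed.

(** The Taylor remainder of the sum is the sum of the remainders of the monomials, which
    [Cmod_pow_taylor] bounds by |h|^2 times a convergent series. *)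
Lemma Cderiv_Cpser (c : nat -> C) (w : C) :
  entire_coeffs c -> Cderiv (Cpser c) w (Cpser (Cpser_deriv c) w).
Proof.
  intros H.
  destruct (proj1 (ex_series_incr_1 _)
              (H (2 * (Cmod w + 1)) ltac:(pose proof (Cmod_ge_0 w); lra))) as [M HM].
  apply Cderiv_quadratic with M 1; [lra|]; intros h Hh.
  apply Cmod_series_le with
    (a := fun n => (c (S n) * ((w + h) ^ S n - w ^ S n - RtoC (INR (S n)) * w ^ n * h))%C)
    (b := fun n => Cmod h ^ 2 * (Cmod (c (S n)) * (2 * (Cmod w + 1)) ^ S n)).
  (* Shifting removes the constant terms, which cancel, and aligns both series with that of the
     derivative. *)
  - pose proof (proj2 (Cis_series_shift _ _) (Cpser_correct c (w + h)%C H)) as H1.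
    pose proof (proj2 (Cis_series_shift _ _) (Cpser_correct c w H)) as H2.
    pose proof (Cpser_correct _ w (entire_coeffs_deriv c H)) as H3.
    apply (Cis_series_scal (- RtoC 1)%C) in H2.
    apply (Cis_series_scal (- h)%C) in H3.
    pose proof (Cis_series_plus _ _ _ _ (Cis_series_plus _ _ _ _ H1 H2) H3) as H4.
    match type of H4 with Cis_series _ ?l =>
      replace (Cpser c (w + h) - Cpser c w - h * Cpser (Cpser_deriv c) w)%C with l end.
    + apply Cis_series_ext with (2 := H4); intros n; unfold Cpser_deriv; cbv beta; ring.
    + simpl; ring.
  - rewrite (Rmult_comm M); exact (is_series_scal_l (V := R_NormedModule) (Cmod h ^ 2) _ _ HM).
  - intros n; rewrite Cmod_mult.
    rewrite <- Rmult_assoc, (Rmult_comm (Cmod h ^ 2)), Rmult_assoc.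
    apply Rmult_le_compat_l; [apply Cmod_ge_0 | apply Cmod_pow_taylor, Hh].
Qed.

Lemma Cderiv_ext_loc (f g : C -> C) (z l : C) :
  locally (T := C_UniformSpace) z (fun w => f w = g w) -> Cderiv f z l -> Cderiv g z l.
Proof.
  intros H; apply (is_derive_ext_loc (V := C_NormedModule)); apply locally_C; exact H.
Qed.

Lemma Cderiv_unique (f : C -> C) (z l l' : C) : Cderiv f z l -> Cderiv f z l' -> l = l'.
Proof.
  intros H H'; transitivity (C_derive f z); [symmetry|]; apply is_C_derive_unique; assumption.
Qed.

(* Coquelicot carries two normed module structures on [C], with different balls. *)
Lemma Cderiv_AbsRing (f : C -> C) (z l : C) :
  is_derive (K := C_AbsRing) (V := AbsRing_NormedModule C_AbsRing) f z l <-> Cderiv f z l.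
Proof. split; intros [_ H]; (split; [apply is_linear_scal_l | exact H]). Qed.

Lemma Cderiv_id (z : C) : Cderiv (fun w => w) z 1.
Proof. apply Cderiv_AbsRing, (is_derive_id (K := C_AbsRing)). Qed.

Lemma Cderiv_const (c z : C) : Cderiv (fun _ => c) z 0.
Proof. exact (is_derive_const (V := C_NormedModule) c z). Qed.

Lemma Cderiv_plus (f g : C -> C) (z l m : C) :
  Cderiv f z l -> Cderiv g z m -> Cderiv (fun w => f w + g w)%C z (l + m)%C.
Proof. exact (is_derive_plus (V := C_NormedModule) f g z l m). Qed.

Lemma Cderiv_mult (f g : C -> C) (z l m : C) :
  Cderiv f z l -> Cderiv g z m -> Cderiv (fun w => f w * g w)%C z (l * g z + f z * m)%C.
Proof.
  intros H H'; apply Cderiv_AbsRing in H, H'; apply Cderiv_AbsRing.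
  exact (is_derive_mult (K := C_AbsRing) f g z l m H H' Cmult_comm).
Qed.

Lemma Cderiv_comp (f g : C -> C) (z l m : C) :
  Cderiv f (g z) l -> Cderiv g z m -> Cderiv (fun w => f (g w)) z (m * l)%C.
Proof.
  intros H H'; apply Cderiv_AbsRing in H'.
  exact (is_derive_comp (V := C_NormedModule) f g z l m H H').
Qed.

Lemma Cderiv_Cexp (z : C) : Cderiv Cexp z (Cexp z).
Proof.
  apply Cderiv_quadratic with (3 * Cmod (Cexp z)) (/ 2); [lra|]; intros h Hh.
  rewrite Cexp_plus.
  replace (Cexp z * Cexp h - Cexp z - h * Cexp z)%C with (Cexp z * (Cexp h - 1 - h))%C
    by ring.
  rewrite Cmod_mult, (Rmult_comm 3), Rmult_assoc.
  apply Rmult_le_compat_l; [apply Cmod_ge_0 | apply Cmod_Cexp_taylor, Hh].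
Qed.

(** * Branches of the logarithm and complex powers *)

Lemma log_branch_near_neq0 (L : C -> C) (x : C) : log_branch_near L x -> x <> RtoC 0.
Proof. intros H; apply locally_singleton in H; destruct H as [<- _]; apply Cexp_neq0. Qed.

(** Differentiating [Cexp (L w) = w] near x gives L'(x) x = 1. *)
Lemma Cderiv_log_branch (L : C -> C) (x : C) : log_branch_near L x -> Cderiv L x (/ x)%C.
Proof.
  intros H; pose proof (log_branch_near_neq0 L x H) as Hx.
  pose proof (locally_singleton _ _ H) as [E HL].
  assert (HL' : exists l, Cderiv L x l) by exact HL; destruct HL' as [l Hl].
  pose proof (Cderiv_comp Cexp L x _ l (Cderiv_Cexp (L x)) Hl) as H1.
  rewrite E in H1.
  assert (H2 : Cderiv (fun w => w) x (l * x)%C).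
  { apply Cderiv_ext_loc with (2 := H1); eapply filter_imp; [|exact H].
    intros w Hw; apply Hw. }
  replace (/ x)%C with l; [exact Hl|].
  pose proof (Cderiv_unique _ _ _ _ H2 (Cderiv_id x)) as E1.
  transitivity ((l * x) / x)%C; [|rewrite E1]; field; exact Hx.
Qed.

Lemma cpow_pred (L : C -> C) (x nu : C) :
  Cexp (L x) = x -> cpow L x nu = (cpow L x (nu - 1) * x)%C.
Proof.
  intros H; unfold cpow; rewrite <- H at 3; rewrite <- Cexp_plus; f_equal; ring.
Qed.

Lemma cpow_plus_even (L : C -> C) (x nu : C) (s : nat) :
  Cexp (L x) = x -> cpow L x (nu + RtoC (INR (2 * s)))%C = (cpow L x nu * (x * x) ^ s)%C.
Proof.
  intros H; induction s as [|s IH].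
  - simpl; rewrite Cplus_0_r; ring.
  - replace (nu + RtoC (INR (2 * S s)))%C
      with ((nu + RtoC (INR (2 * s))) + 1 + 1)%C
      by (replace (2 * S s)%nat with (S (S (2 * s))) by lia;
          rewrite !S_INR, !RtoC_plus; ring).
    rewrite !(cpow_pred L x (_ + 1)) by exact H.
    replace (nu + RtoC (INR (2 * s)) + 1 + 1 - 1)%C
      with (nu + RtoC (INR (2 * s)) + 1)%C by ring.
    rewrite (cpow_pred L x (_ + 1)) by exact H.
    replace (nu + RtoC (INR (2 * s)) + 1 - 1)%C
      with (nu + RtoC (INR (2 * s)))%C by ring.
    rewrite IH; simpl; ring.
Qed.

(** The argument z / 2 of the series is differentiated on its own, for use in chain rules. *)
Lemma Cderiv_half (z : C) : Cderiv (fun w => w / 2)%C z (/ 2)%C.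
Proof.
  replace (/ 2)%C with (1 * / 2 + z * 0)%C by ring.
  apply (Cderiv_mult (fun w => w) (fun _ => / 2)%C);
    [apply Cderiv_id | apply Cderiv_const].
Qed.

(** The factor 1 / (z / 2) from the logarithm is absorbed into the exponent nu - 1, so later
    formulas contain no division by z. *)
Lemma Cderiv_cpow_half (L : C -> C) (nu z : C) : log_branch_near L (z / 2)%C ->
  Cderiv (fun w => cpow L (w / 2) nu)%C z (nu / 2 * cpow L (z / 2) (nu - 1))%C.
Proof.
  intros H; pose proof (log_branch_near_neq0 _ _ H) as Hz.
  pose proof (locally_singleton _ _ H) as [E _].
  pose proof (Cderiv_comp _ (fun w => w / 2)%C _ _ _
                (Cderiv_log_branch _ _ H) (Cderiv_half z)) as H1.
  pose proof (Cderiv_mult _ _ _ _ _ (Cderiv_const nu z) H1) as H2; cbv beta in H2.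
  pose proof (Cderiv_comp _ _ _ _ _ (Cderiv_Cexp _) H2) as H3.
  match type of H3 with Cderiv _ _ ?l =>
    replace (nu / 2 * cpow L (z / 2) (nu - 1))%C with l; [exact H3|] end.
  change (Cexp (nu * L (z / 2)))%C with (cpow L (z / 2) nu)%C.
  rewrite (cpow_pred L _ nu) by exact E.
  set (x := (z / 2)%C) in *; field; repeat split; auto using C2_neq0.
Qed.

(** * The Bessel equation *)

Definition bessel_coeff (nu : C) (s : nat) : C :=
  (RtoC ((-1) ^ s / INR (fact s)) * rGamma (nu + RtoC (INR s) + 1))%C.

(** By [rGamma_rec], |1/Gamma(a + 1)| <= |1/Gamma(a)| as soon as |a| >= 1. With a = nu + n + 1 this
    holds once n >= |nu|, so the sequence is eventually nonincreasing in modulus. *)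
Lemma rGamma_shift_bounded (nu : C) :
  exists (M : R) (N : nat), forall s, Cmod (rGamma (nu + RtoC (INR (N + s)) + 1)) <= M.
Proof.
  destruct (nfloor_ex (Cmod nu + 1)) as [N [_ HN]]; [pose proof (Cmod_ge_0 nu); lra|].
  exists (Cmod (rGamma (nu + RtoC (INR (S N)) + 1))), (S N).
  induction s as [|s IH]; [rewrite Nat.add_0_r; apply Rle_refl|].
  eapply Rle_trans; [|exact IH].
  rewrite Nat.add_succ_r, S_INR, RtoC_plus.
  set (n := RtoC (INR (S N + s))).
  rewrite (rGamma_rec (nu + n + 1)), Cmod_mult, Cplus_assoc.
  assert (H : 1 <= Cmod (nu + n + 1)).
  { replace (nu + n + 1)%C with (RtoC (INR (S N + s) + 1) + nu)%C
      by (unfold n; rewrite RtoC_plus; ring).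
    pose proof (Cmod_triangle (RtoC (INR (S N + s) + 1) + nu) (- nu)) as T.
    replace (RtoC (INR (S N + s) + 1) + nu + - nu)%C with (RtoC (INR (S N + s) + 1)) in T
      by ring.
    pose proof (pos_INR s); rewrite plus_INR, S_INR in *.
    rewrite Cmod_opp, Cmod_R, Rabs_pos_eq in T; pose proof (Cmod_ge_0 nu); lra. }
  pose proof (Cmod_ge_0 (rGamma (nu + n + 1 + 1))); nra.
Qed.

(** Past the index [N], the terms are at most M r^n / n!, a tail of the exponential series. *)
Lemma entire_bessel_coeff (nu : C) : entire_coeffs (bessel_coeff nu).
Proof.
  intros r Hr; destruct (rGamma_shift_bounded nu) as [M [N HM]].
  apply (ex_series_incr_n _ N).
  assert (He : ex_series (fun n => / INR (fact n) * r ^ n)).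
  { exists (exp r); apply is_series_ext with (2 := is_exp_Reals r); intros n.
    rewrite Rmult_comm, pow_n_pow; reflexivity. }
  apply (ex_series_incr_n _ N), (ex_series_scal_l (V := R_NormedModule) M) in He.
  apply (ex_series_le (V := R_CompleteNormedModule)) with (2 := He); intros n.
  change (Rabs (Cmod (bessel_coeff nu (N + n)) * r ^ (N + n))
          <= M * (/ INR (fact (N + n)) * r ^ (N + n))).
  pose proof (pow_le r (N + n) Hr) as Hp.
  rewrite Rabs_pos_eq by (apply Rmult_le_pos; [apply Cmod_ge_0 | exact Hp]).
  rewrite <- Rmult_assoc; apply Rmult_le_compat_r; [exact Hp|].
  pose proof (Rinv_0_lt_compat _ (INR_fact_lt_0 (N + n))) as Hf.
  unfold bessel_coeff, Rdiv; rewrite Cmod_mult, Cmod_R, Rabs_mult, pow_1_abs, Rmult_1_l.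
  rewrite (Rabs_pos_eq (/ _)), Rmult_comm by lra.
  apply Rmult_le_compat_r; [lra | apply HM].
Qed.

(** Kept free of division by nu + s + 1, so that it also covers negative integer orders, where this
    factor can vanish. *)
Lemma bessel_coeff_rec (nu : C) (s : nat) :
  (bessel_coeff nu s
   + (nu + RtoC (INR (S s))) * (RtoC (INR (S s)) * bessel_coeff nu (S s)))%C = RtoC 0.
Proof.
  unfold bessel_coeff.
  rewrite (rGamma_rec (nu + RtoC (INR s) + 1)).
  rewrite S_INR at 3; rewrite RtoC_plus, Cplus_assoc.
  set (g := rGamma _).
  replace ((-1) ^ s / INR (fact s)) with (- (INR (S s) * ((-1) ^ S s / INR (fact (S s))))).
  - rewrite RtoC_opp, RtoC_mult, S_INR, RtoC_plus; ring.
  - rewrite fact_simpl, mult_INR; simpl ((-1) ^ S s); field.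
    split; [apply INR_fact_neq_0 | apply not_0_INR; lia].
Qed.

Lemma bessel_pser_ode (nu w : C) :
  let c := bessel_coeff nu in
  (Cpser c w + (nu + 1) * Cpser (Cpser_deriv c) w
   + w * Cpser (Cpser_deriv (Cpser_deriv c)) w)%C = RtoC 0.
Proof.
  intros c; pose proof (entire_bessel_coeff nu) as H0; fold c in H0.
  pose proof (entire_coeffs_deriv _ H0) as H1; pose proof (entire_coeffs_deriv _ H1) as H2.
  pose proof (Cpser_correct _ w H0) as S0.
  pose proof (Cis_series_scal (nu + 1) _ _ (Cpser_correct _ w H1)) as S1.
  pose proof (Cis_series_scal w _ _ (Cpser_correct _ w H2)) as S2.
  set (T := Cpser (Cpser_deriv (Cpser_deriv c)) w) in *.
  (* [w F''] as a series in [w ^ n], with a vanishing term at [n = 0] *)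
  assert (S2' : Cis_series (fun n => RtoC (INR n) * Cpser_deriv c n * w ^ n)%C (w * T)%C).
  { apply Cis_series_shift; cbv beta.
    replace (w * T - RtoC (INR 0) * Cpser_deriv c 0 * w ^ 0)%C with (w * T)%C
      by (simpl; ring).
    apply Cis_series_ext with (2 := S2); intros n.
    unfold Cpser_deriv at 1; rewrite Cpow_S; ring. }
  pose proof (Cis_series_plus _ _ _ _ (Cis_series_plus _ _ _ _ S0 S1) S2') as S3.
  apply (Cis_series_unique _ _ _ S3).
  (* The coefficient of w^n is c_n + (nu + n + 1) (n + 1) c_(n + 1), zero by the recurrence. Writing
     the terms as 0 times those of F lets the zero series be summed as a multiple of F. *)
  apply Cis_series_ext with (a := fun n => (0 * (c n * w ^ n))%C).
  - intros n; transitivity ((c n + (nu + RtoC (INR (S n))) * Cpser_deriv c n) * w ^ n)%C.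
    + unfold Cpser_deriv, c; rewrite bessel_coeff_rec; ring.
    + rewrite S_INR, RtoC_plus; ring.
  - rewrite <- (Cmult_0_l (Cpser c w)) at 1; apply Cis_series_scal, S0.
Qed.

(** The classical J_nu(z), with (z / 2)^nu taken out of the series; [Cbessel_series] recovers the
    defining one. *)
Definition Cbessel (L : C -> C) (nu z : C) : C :=
  let w := (z / 2 * (z / 2))%C in (cpow L (z / 2) nu * Cpser (bessel_coeff nu) w)%C.

(** With x = z / 2 and w = x^2, the derivative of x^nu F(w) in z is (nu / 2) x^(nu - 1) F + x^(nu +
    1) F'; here x^(nu - 1) is factored out, and x^(nu - 2) in the second derivative below. *)
Definition Cbessel' (L : C -> C) (nu z : C) : C :=
  let w := (z / 2 * (z / 2))%C in
  let c := bessel_coeff nu in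
  (cpow L (z / 2) (nu - 1) * (nu / 2 * Cpser c w + w * Cpser (Cpser_deriv c) w))%C.

Definition Cbessel'' (L : C -> C) (nu z : C) : C :=
  let w := (z / 2 * (z / 2))%C in
  let c := bessel_coeff nu in
  (cpow L (z / 2) (nu - 1 - 1)
   * ((nu - 1) / 2 * (nu / 2 * Cpser c w + w * Cpser (Cpser_deriv c) w)
      + w * ((nu / 2 + 1) * Cpser (Cpser_deriv c) w
             + w * Cpser (Cpser_deriv (Cpser_deriv c)) w)))%C.

Lemma Cderiv_half_sqr (z : C) : Cderiv (fun w => w / 2 * (w / 2))%C z (z / 2)%C.
Proof.
  pose proof (Cderiv_mult _ _ _ _ _ (Cderiv_half z) (Cderiv_half z)) as H; cbv beta in H.
  replace (z / 2)%C with (/ 2 * (z / 2) + z / 2 * / 2)%C by (field; exact C2_neq0).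
  exact H.
Qed.

Lemma Cderiv_Cpser_half_sqr (c : nat -> C) (z : C) : entire_coeffs c ->
  Cderiv (fun w => Cpser c (w / 2 * (w / 2)))%C z
    (z / 2 * Cpser (Cpser_deriv c) (z / 2 * (z / 2)))%C.
Proof.
  intros H.
  exact (Cderiv_comp _ _ _ _ _ (Cderiv_Cpser c _ H) (Cderiv_half_sqr z)).
Qed.

Lemma Cderiv_Cbessel (L : C -> C) (nu z : C) : log_branch_near L (z / 2)%C ->
  Cderiv (Cbessel L nu) z (Cbessel' L nu z).
Proof.
  intros H; pose proof (locally_singleton _ _ H) as [E _].
  pose proof (Cderiv_mult _ _ _ _ _ (Cderiv_cpow_half L nu z H)
                (Cderiv_Cpser_half_sqr _ z (entire_bessel_coeff nu))) as D.
  match type of D with Cderiv _ _ ?l =>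
    replace (Cbessel' L nu z) with l; [exact D|] end.
  unfold Cbessel'; rewrite (cpow_pred L _ nu) by exact E; ring.
Qed.

Lemma Cderiv_Cbessel' (L : C -> C) (nu z : C) : log_branch_near L (z / 2)%C ->
  Cderiv (Cbessel' L nu) z (Cbessel'' L nu z).
Proof.
  intros H; pose proof (locally_singleton _ _ H) as [E _].
  pose proof (entire_bessel_coeff nu) as H0.
  pose proof (entire_coeffs_deriv _ H0) as H1.
  pose proof (Cderiv_mult _ _ _ _ _ (Cderiv_const (nu / 2)%C z)
                (Cderiv_Cpser_half_sqr _ z H0)) as D1.
  pose proof (Cderiv_mult _ _ _ _ _ (Cderiv_half_sqr z)
                (Cderiv_Cpser_half_sqr _ z H1)) as D2.
  pose proof (Cderiv_mult _ _ _ _ _ (Cderiv_cpow_half L (nu - 1)%C z H)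
                (Cderiv_plus _ _ _ _ _ D1 D2)) as D.
  cbv beta in D; match type of D with Cderiv _ _ ?l =>
    replace (Cbessel'' L nu z) with l; [exact D|] end.
  unfold Cbessel''; rewrite (cpow_pred L _ (nu - 1)) by exact E.
  set (x := (z / 2)%C); field; exact C2_neq0.
Qed.

Lemma Cbessel_ode (L : C -> C) (nu z : C) : log_branch_near L (z / 2)%C ->
  (z * z * Cbessel'' L nu z + z * Cbessel' L nu z + (z * z - nu * nu) * Cbessel L nu z)%C
  = RtoC 0.
Proof.
  intros H; pose proof (locally_singleton _ _ H) as [E _].
  unfold Cbessel, Cbessel', Cbessel''.
  rewrite (cpow_pred L _ nu), (cpow_pred L _ (nu - 1)) by exact E.
  pose proof (bessel_pser_ode nu (z / 2 * (z / 2))%C) as O; cbv zeta in O.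
  assert (Ez : z = (2 * (z / 2))%C) by (field; exact C2_neq0).
  set (P := cpow _ _ _); set (x := (z / 2)%C) in *; clearbody P x; subst z.
  set (F := Cpser (bessel_coeff nu) _) in *.
  set (F1 := Cpser (Cpser_deriv (bessel_coeff nu)) _) in *.
  set (F2 := Cpser (Cpser_deriv (Cpser_deriv (bessel_coeff nu))) _) in *.
  (* With z = 2 x and every power reduced to P = x^(nu - 2), the left-hand side is 4 P x^4 times the
     equation satisfied by F at w = x^2. *)
  transitivity (P * (x * x) * (4 * (x * x)) * (F + (nu + 1) * F1 + x * x * F2))%C.
  - field; exact C2_neq0.
  - rewrite O; ring.
Qed.

(** * Idempotent components *)

Lemma BC_idem_ext (X Y : BC) : idem1 X = idem1 Y -> idem2 X = idem2 Y -> X = Y.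
Proof. intros H1 H2; rewrite <- (of_idemK X), <- (of_idemK Y), H1, H2; reflexivity. Qed.

Lemma idem1_plus (X Y : BC) : idem1 (X + Y)%BC = (idem1 X + idem1 Y)%C.
Proof. unfold idem1; simpl; ring. Qed.

Lemma idem2_plus (X Y : BC) : idem2 (X + Y)%BC = (idem2 X + idem2 Y)%C.
Proof. unfold idem2; simpl; ring. Qed.

Lemma idem1_minus (X Y : BC) : idem1 (X - Y)%BC = (idem1 X - idem1 Y)%C.
Proof. unfold idem1; simpl; ring. Qed.

Lemma idem2_minus (X Y : BC) : idem2 (X - Y)%BC = (idem2 X - idem2 Y)%C.
Proof. unfold idem2; simpl; ring. Qed.

Lemma idem1_mult (X Y : BC) : idem1 (X * Y)%BC = (idem1 X * idem1 Y)%C.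
Proof.
  unfold idem1; simpl.
  transitivity (fst X * fst Y + (Ci * Ci) * (snd X * snd Y)
                - Ci * (fst X * snd Y + snd X * fst Y))%C; [rewrite Ci_sqr|]; ring.
Qed.

Lemma idem2_mult (X Y : BC) : idem2 (X * Y)%BC = (idem2 X * idem2 Y)%C.
Proof.
  unfold idem2; simpl.
  transitivity (fst X * fst Y + (Ci * Ci) * (snd X * snd Y)
                + Ci * (fst X * snd Y + snd X * fst Y))%C; [rewrite Ci_sqr|]; ring.
Qed.

Lemma idem1_CtoBC (a : C) : idem1 (CtoBC a) = a.
Proof. unfold idem1; simpl; ring. Qed.

Lemma idem2_CtoBC (a : C) : idem2 (CtoBC a) = a.
Proof. unfold idem2; simpl; ring. Qed.

Lemma not_O2_idem (W : BC) : ~ O2 W -> idem1 W <> RtoC 0 /\ idem2 W <> RtoC 0.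
Proof. intros H; split; intros E; apply H, O2_idem; rewrite E; ring. Qed.

Lemma idem1_div (X W : BC) : ~ O2 W -> idem1 (X / W)%BC = (idem1 X / idem1 W)%C.
Proof.
  intros H; destruct (not_O2_idem W H) as [H1 _].
  pose proof (f_equal idem1 (BCmult_inv W H)) as E; rewrite idem1_mult, idem1_CtoBC in E.
  unfold BCdiv; rewrite idem1_mult.
  transitivity (idem1 X * (idem1 W * idem1 (BCinv W)) / idem1 W)%C;
    [|rewrite E]; field; exact H1.
Qed.

Lemma idem2_div (X W : BC) : ~ O2 W -> idem2 (X / W)%BC = (idem2 X / idem2 W)%C.
Proof.
  intros H; destruct (not_O2_idem W H) as [_ H1].
  pose proof (f_equal idem2 (BCmult_inv W H)) as E; rewrite idem2_mult, idem2_CtoBC in E.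
  unfold BCdiv; rewrite idem2_mult.
  transitivity (idem2 X * (idem2 W * idem2 (BCinv W)) / idem2 W)%C;
    [|rewrite E]; field; exact H1.
Qed.

Lemma not_O2_CtoBC_2 : ~ O2 (CtoBC 2).
Proof. exact C4_neq0. Qed.

(** * Limits and derivatives by components *)

(** The coordinates (u + v) / 2 and i (u - v) / 2 are linear in the idempotent components, and balls
    of BC are products, so the two coordinate limits suffice. *)
Lemma filterlim_of_idem {T : Type} (F : (T -> Prop) -> Prop) {FF : Filter F}
    (f g : T -> C) (a b : C) :
  filterlim f F (locally (T := C_UniformSpace) a) ->
  filterlim g F (locally (T := C_UniformSpace) b) ->
  filterlim (fun x => of_idem (f x) (g x)) F
    (locally (T := BC_NormedModule) (of_idem a b)).
Proof.
  intros Hf Hg.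
  assert (H1 : filterlim (fun x => scal (/ 2)%C (plus (f x) (g x))) F
                 (locally (scal (V := C_NormedModule) (/ 2)%C (plus a b)))).
  { eapply filterlim_comp; [|apply (filterlim_scal_r (V := C_NormedModule))].
    eapply filterlim_comp_2; [exact Hf | exact Hg |].
    apply (filterlim_plus (V := C_NormedModule)). }
  assert (H2 : filterlim (fun x => scal (Ci / 2)%C (plus (f x) (opp (g x)))) F
                 (locally (scal (V := C_NormedModule) (Ci / 2)%C (plus a (opp b))))).
  { eapply filterlim_comp; [|apply (filterlim_scal_r (V := C_NormedModule))].
    eapply filterlim_comp_2; [exact Hf | | apply (filterlim_plus (V := C_NormedModule))].
    eapply filterlim_comp; [exact Hg | apply (filterlim_opp (V := C_NormedModule))]. }
  assert (E : forall u v, of_idem u v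
                = (scal (V := C_NormedModule) (/ 2)%C (plus u v),
                   scal (V := C_NormedModule) (Ci / 2)%C (plus u (opp v)))).
  { intros u v; rewrite of_idemE.
    apply injective_projections;
      [change ((u + v) / 2 = / 2 * (u + v))%C
      |change (Ci * (u - v) / 2 = Ci / 2 * (u + - v))%C]; field; exact C2_neq0. }
  apply filterlim_locally; intros eps.
  pose proof (proj1 (filterlim_locally _ _) H1 eps) as B1.
  pose proof (proj1 (filterlim_locally _ _) H2 eps) as B2.
  generalize (filter_and _ _ B1 B2); apply filter_imp; intros x [C1 C2].
  rewrite !E; split; assumption.
Qed.

Lemma filterlim_idem1 (Z : BC) :
  filterlim idem1 (locally (T := BC_NormedModule) Z)
    (locally (T := C_UniformSpace) (idem1 Z)).
Proof.
  apply (continuous_minus (K := C_AbsRing) (U := BC_NormedModule) (V := C_NormedModule)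
           fst (fun Z => Ci * snd Z)%C Z).
  - apply continuous_fst.
  - apply (continuous_scal_r (V := C_NormedModule) Ci snd), continuous_snd.
Qed.

Lemma filterlim_idem2 (Z : BC) :
  filterlim idem2 (locally (T := BC_NormedModule) Z)
    (locally (T := C_UniformSpace) (idem2 Z)).
Proof.
  apply (continuous_plus (K := C_AbsRing) (U := BC_NormedModule) (V := C_NormedModule)
           fst (fun Z => Ci * snd Z)%C Z).
  - apply continuous_fst.
  - apply (continuous_scal_r (V := C_NormedModule) Ci snd), continuous_snd.
Qed.

Lemma Cderiv_quotient (f : C -> C) (z l : C) : Cderiv f z l ->
  filterlim (fun w => (f w - f z) / (w - z))%C
    (within (fun w => w <> z) (locally (T := C_UniformSpace) z))
    (locally (T := C_UniformSpace) l).
Proof.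
  intros H; apply filterlim_locally; intros eps; unfold within.
  (* Half of [eps] turns the non-strict estimate into the strict one that a ball demands. *)
  destruct (proj1 (Cderiv_eps f z l) H (pos_div_2 eps)) as [d Hd].
  apply locally_C; exists d; intros w Hw Hwz.
  assert (Hn : (w - z)%C <> RtoC 0).
  { intros E0; apply Hwz.
    assert (E : (w - z + z)%C = w) by ring; rewrite <- E, E0; ring. }
  specialize (Hd (w - z)%C Hw); simpl in Hd.
  assert (Ew : (z + (w - z))%C = w) by ring; rewrite Ew in Hd.
  apply C_NormedModule_mixin_compat1.
  change (Cmod ((f w - f z) / (w - z) - l) < eps)%C.
  replace ((f w - f z) / (w - z) - l)%C with ((f w - f z - (w - z) * l) / (w - z))%C
    by (field; exact Hn).
  rewrite Cmod_div by exact Hn.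
  apply Cmod_gt_0 in Hn; pose proof (cond_pos eps).
  apply Rmult_lt_reg_r with (Cmod (w - z)); [exact Hn|].
  unfold Rdiv; rewrite Rmult_assoc, Rinv_l by lra.
  rewrite Rmult_1_r; nra.
Qed.

(** An increment W - Z outside O2 has both idempotent components nonzero, so the bicomplex quotient
    is the pair of complex quotients. Agreement near Z is assumed rather than everywhere because the
    Bessel function splits only where [L] is a branch. *)
Lemma is_BC_derive_of_idem (g : BC -> BC) (f1 f2 : C -> C) (Z : BC) (l1 l2 : C) :
  locally (T := BC_NormedModule) Z (fun W => g W = of_idem (f1 (idem1 W)) (f2 (idem2 W))) ->
  Cderiv f1 (idem1 Z) l1 -> Cderiv f2 (idem2 Z) l2 ->
  is_BC_derive g Z (of_idem l1 l2).
Proof.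
  intros Hg H1 H2; unfold is_BC_derive.
  pose proof (locally_singleton _ _ Hg) as HZ; cbv beta in HZ.
  assert (FF : Filter (within (fun W => ~ O2 (W - Z)%BC) (locally (T := BC_NormedModule) Z)))
    by apply within_filter, locally_filter.
  apply filterlim_ext_loc with
    (f := fun W => of_idem ((f1 (idem1 W) - f1 (idem1 Z)) / (idem1 W - idem1 Z))
                           ((f2 (idem2 W) - f2 (idem2 Z)) / (idem2 W - idem2 Z))).
  - unfold within; eapply filter_imp; [|exact Hg].
    intros W HW HO; cbv beta in HW; rewrite HW, HZ.
    apply BC_idem_ext;
      rewrite ?idem1K, ?idem2K, ?idem1_div, ?idem2_div, ?idem1_minus, ?idem2_minus,
        ?idem1K, ?idem2K by exact HO; reflexivity.
  - apply filterlim_of_idem.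
    + exact FF.
    + refine (filterlim_comp _ _ _ idem1 _ _ _ _ _ (Cderiv_quotient _ _ _ H1)).
      (* The projection sends the W with W - Z outside O2 to points other than that of Z, hence into
         punctured neighbourhoods. *)
      intros P HP; unfold filtermap, within in *.
      apply (filterlim_idem1 Z) in HP; unfold filtermap in HP.
      eapply filter_imp; [|exact HP]; intros W HW HO; apply HW.
      intros E; apply (proj1 (not_O2_idem _ HO)); rewrite idem1_minus, E; ring.
    + refine (filterlim_comp _ _ _ idem2 _ _ _ _ _ (Cderiv_quotient _ _ _ H2)).
      intros P HP; unfold filtermap, within in *.
      apply (filterlim_idem2 Z) in HP; unfold filtermap in HP.
      eapply filter_imp; [|exact HP]; intros W HW HO; apply HW.
      intros E; apply (proj2 (not_O2_idem _ HO)); rewrite idem2_minus, E; ring.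
Qed.

Lemma BC_Series_of_idem (a : nat -> BC) (a1 a2 : nat -> C) (l1 l2 : C) :
  (forall n, a n = of_idem (a1 n) (a2 n)) ->
  Cis_series a1 l1 -> Cis_series a2 l2 -> BC_Series a = of_idem l1 l2.
Proof.
  intros Ha H1 H2.
  assert (H : is_series (V := BC_NormedModule) a (of_idem l1 l2)).
  { unfold is_series.
    apply filterlim_ext with
      (f := fun n => of_idem (sum_n (G := C_NormedModule) a1 n)
                             (sum_n (G := C_NormedModule) a2 n)).
    - induction x as [|n IH]; [rewrite !sum_O, Ha; reflexivity|].
      rewrite !sum_Sn, <- IH, Ha.
      apply BC_idem_ext; rewrite ?idem1_plus, ?idem2_plus, ?idem1K, ?idem2K; reflexivity.
    - apply filterlim_of_idem; [apply eventually_filter | exact H1 | exact H2]. }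
  (* The value chosen by [epsilon] is a sum of the series, and the sum is unique. *)
  apply (filterlim_locally_unique (V := BC_NormedModule) (F := eventually)
           (sum_n (G := BC_NormedModule) a)); [|exact H].
  unfold BC_Series; apply (epsilon_spec (inhabits (CtoBC 0)) (is_series (V := BC_NormedModule) a)).
  exists (of_idem l1 l2); exact H.
Qed.

(** * The bicomplex Bessel function by components *)

Lemma Cbessel_series (L : C -> C) (nu z : C) : Cexp (L (z / 2)%C) = (z / 2)%C ->
  Cis_series (fun s => RtoC ((-1) ^ s / INR (fact s)) * rGamma (nu + RtoC (INR s) + 1)
                       * cpow L (z / 2) (nu + RtoC (INR (2 * s))))%C
    (Cbessel L nu z).
Proof.
  intros E.
  pose proof (Cis_series_scal (cpow L (z / 2) nu) _ _
    (Cpser_correct _ (z / 2 * (z / 2))%C (entire_bessel_coeff nu))) as H.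
  apply Cis_series_ext with (2 := H); intros s.
  rewrite cpow_plus_even by exact E; unfold bessel_coeff; ring.
Qed.

Lemma bessel_of_idem (L : C -> C) (N Z : BC) :
  Cexp (L (idem1 Z / 2)%C) = (idem1 Z / 2)%C ->
  Cexp (L (idem2 Z / 2)%C) = (idem2 Z / 2)%C ->
  bessel L N Z = of_idem (Cbessel L (idem1 N) (idem1 Z)) (Cbessel L (idem2 N) (idem2 Z)).
Proof.
  intros H1 H2; unfold bessel.
  eapply BC_Series_of_idem; [|apply Cbessel_series, H1 | apply Cbessel_series, H2].
  intros s; unfold bessel_term, rGamma_b, BCpow.
  apply BC_idem_ext;
    rewrite ?idem1_mult, ?idem2_mult, ?idem1K, ?idem2K, ?idem1_plus, ?idem2_plus,
      ?idem1_CtoBC, ?idem2_CtoBC, ?idem1_div, ?idem2_div, ?idem1_CtoBC, ?idem2_CtoBC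
      by exact not_O2_CtoBC_2; reflexivity.
Qed.

(** Being a branch near a point is an open condition, pulled back here along W -> p W / 2. A second
    derivative at Z needs the first one on a whole neighbourhood. *)
Lemma locally_log_branch (L : C -> C) (p : BC -> C) (Z : BC) :
  filterlim p (locally (T := BC_NormedModule) Z) (locally (T := C_UniformSpace) (p Z)) ->
  log_branch_near L (p Z / 2)%C ->
  locally (T := BC_NormedModule) Z (fun W => log_branch_near L (p W / 2)%C).
Proof.
  intros Hp H.
  assert (Hc : filterlim (fun W => scal (/ 2)%C (p W)) (locally (T := BC_NormedModule) Z)
                 (locally (scal (V := C_NormedModule) (/ 2)%C (p Z)))).
  { eapply filterlim_comp; [exact Hp | apply (filterlim_scal_r (V := C_NormedModule))]. }
  apply locally_locally in H.
  change (scal (V := C_NormedModule) (/ 2)%C (p Z)) with (/ 2 * p Z)%C in Hc.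
  rewrite Cmult_comm in Hc; apply Hc in H; unfold filtermap in H.
  eapply filter_imp; [|exact H]; intros W HW.
  unfold log_branch_near, Cdiv; rewrite Cmult_comm; exact HW.
Qed.

Theorem theorem4p2 (L : C -> C) (N Z : BC)
    (hZ : ~ O2 Z)
    (hL1 : log_branch_near L (idem1 (Z / CtoBC 2)%BC))
    (hL2 : log_branch_near L (idem2 (Z / CtoBC 2)%BC)) :
  exists V1 V2 : BC,
    is_BC_derive (bessel L N) Z V1 /\
    is_BC_derive2 (bessel L N) Z V2 /\
    (Z * Z * V2 + Z * V1 + (Z * Z - N * N) * bessel L N Z)%BC = CtoBC 0.
Proof.
  rewrite idem1_div, idem1_CtoBC in hL1 by exact not_O2_CtoBC_2.
  rewrite idem2_div, idem2_CtoBC in hL2 by exact not_O2_CtoBC_2.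
  assert (HL : locally (T := BC_NormedModule) Z (fun W =>
            log_branch_near L (idem1 W / 2)%C /\ log_branch_near L (idem2 W / 2)%C))
    by (apply filter_and; apply locally_log_branch;
        auto using filterlim_idem1, filterlim_idem2).
  assert (HB : forall W,
            log_branch_near L (idem1 W / 2)%C /\ log_branch_near L (idem2 W / 2)%C ->
            bessel L N W = of_idem (Cbessel L (idem1 N) (idem1 W))
                                   (Cbessel L (idem2 N) (idem2 W))).
  { intros W [H1 H2]; apply bessel_of_idem;
      [apply (locally_singleton _ _ H1) | apply (locally_singleton _ _ H2)]. }
  pose (B' := fun W => of_idem (Cbessel' L (idem1 N) (idem1 W))
                               (Cbessel' L (idem2 N) (idem2 W))).
  assert (HD : locally (T := BC_NormedModule) Z (fun W => is_BC_derive (bessel L N) W (B' W))).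
  (* Differentiating at each W near Z needs the splitting of the Bessel function near that W, hence
     the doubled neighbourhood. *)
  { apply locally_locally in HL; eapply filter_imp; [|exact HL]; intros W HW.
    destruct (locally_singleton _ _ HW) as [H1 H2].
    eapply is_BC_derive_of_idem;
      [eapply filter_imp; [exact HB | exact HW] | |]; apply Cderiv_Cbessel; assumption. }
  exists (B' Z), (of_idem (Cbessel'' L (idem1 N) (idem1 Z)) (Cbessel'' L (idem2 N) (idem2 Z))).
  split; [exact (locally_singleton _ _ HD) | split].
  (* [B'] is componentwise by construction, so its splitting holds at every W. *)
  - exists B'; split; [exact HD|].
    eapply is_BC_derive_of_idem;
      [apply filter_forall; intros W; reflexivity | |]; apply Cderiv_Cbessel'; assumption.
  (* Ring operations act on idempotent components separately, leaving one classical Bessel equation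
     in each. *)
  - rewrite (HB Z) by (split; assumption); unfold B'.
    apply BC_idem_ext;
      rewrite ?idem1_plus, ?idem2_plus, ?idem1_mult, ?idem2_mult, ?idem1_minus,
        ?idem2_minus, ?idem1_mult, ?idem2_mult, ?idem1K, ?idem2K, ?idem1_CtoBC,
        ?idem2_CtoBC; apply Cbessel_ode; assumption.
Qed.
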